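(* For every integer $n \geq 2$, the critical exponent $m(n)$ equals $n-2$. Moreover, for every integer $n \geq 2$ and every real $\alpha \geq 0$, the function $g(x) = x^\alpha$ preserves $DN_n$ (that is, $A^\alpha \in DN_n$ for all $A \in DN_n$) if and only if $\alpha \in \mathbb{N} \cup [n-2,\infty)$, where $\mathbb{N} = \{0,1,2,\dots\}$.
   Context: A real symmetric $n \times n$ matrix is doubly nonnegative if it is both positive semidefinite and entrywise nonnegative; $DN_n$ denotes the set of all such matrices. For $A \in DN_n$ with spectral decomposition $A = U D U^T$ ($U$ real orthogonal, $D = \mathrm{diag}(d_{11},\dots,d_{nn})$) and real $\alpha \geq 0$, the conventional power is $A^\alpha := U\,\mathrm{diag}(d_{11}^\alpha,\dots,d_{nn}^\alpha)\,U^T$ (with $0^0 = 1$). The critical exponent $m(n)$ is the smallest real number $\mu \geq 0$ such that $A^\alpha \in DN_n$ for all $A \in DN_n$ and all real $\alpha \geq \mu$. *)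

(* Defs.v *)
From mathcomp Require Import all_boot all_order all_algebra.
From mathcomp Require Import all_classical all_reals all_analysis.

Set Implicit Arguments.
Unset Strict Implicit.
Unset Printing Implicit Defensive.

Import Order.TTheory GRing.Theory Num.Theory.
Local Open Scope classical_set_scope.
Local Open Scope ring_scope.

Section DoublyNonnegative.
Variables (R : realType) (n : nat).

Definition possemidef (A : 'M[R]_n) : Prop :=
  A^T = A /\ forall x : 'cV[R]_n, 0 <= (x^T *m A *m x) ord0 ord0.

Definition DN : set 'M[R]_n :=
  [set A | possemidef A /\ forall i j, 0 <= A i j].

Definition orthogonal_mx (U : 'M[R]_n) : Prop :=
  U *m U^T = 1%:M /\ U^T *m U = 1%:M.

Definition spectral_decomposition (A : 'M[R]_n) (Ud : 'M[R]_n * 'rV[R]_n) :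
  Prop := orthogonal_mx Ud.1 /\ A = Ud.1 *m diag_mx Ud.2 *m Ud.1^T.

(* [powR] satisfies [0 `^ 0 = 1] and [0 `^ alpha = 0] for [alpha != 0]. *)
Definition powmx_of (Ud : 'M[R]_n * 'rV[R]_n) (alpha : R) : 'M[R]_n :=
  Ud.1 *m diag_mx (\row_i (Ud.2 ord0 i `^ alpha)) *m Ud.1^T.

(* The decomposition picked by [xget] is immaterial, see [powmxE]. The default
   [(1%:M, 0)] is used only if [A] has no spectral decomposition, i.e., if [A]
   is not symmetric. *)
Definition powmx (A : 'M[R]_n) (alpha : R) : 'M[R]_n :=
  powmx_of (xget (1%:M, 0) (spectral_decomposition A)) alpha.

Lemma powmxE (A : 'M[R]_n) Ud (alpha : R) :
  spectral_decomposition A Ud -> powmx A alpha = powmx_of Ud alpha.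
Proof.
move=> AUd; rewrite /powmx; case: xgetP => [Ve _|/(_ Ud)//].
move: Ve Ud AUd => [V e] [U d] [/= [UUT UTU] AE] [/= [VVT VTV] AE'].
rewrite /powmx_of /=; set De := diag_mx _; set Dd := diag_mx _.
have WE : V^T *m U *m diag_mx d = diag_mx e *m (V^T *m U).
  have : V^T *m A *m U = V^T *m A *m U by [].
  rewrite [in LHS]AE [in RHS]AE' !mulmxA VTV mul1mx => <-.
  by rewrite -!mulmxA UTU mulmx1.
have WE' : V^T *m U *m Dd = De *m (V^T *m U).
  apply/matrixP => i j; move/matrixP/(_ i j): WE.
  rewrite !mul_mx_diag !mul_diag_mx !mxE.
  set w := \sum_(_ | _) _; have [->|w0] := eqVneq w 0.
    by rewrite !mul0r !mulr0.
  by rewrite mulrC => /(mulIf w0) ->; rewrite mulrC.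
have : V *m (V^T *m U *m Dd) *m U^T = V *m (De *m (V^T *m U)) *m U^T.
  by rewrite WE'.
by rewrite !mulmxA VVT mul1mx -!mulmxA UUT mulmx1 => ->.
Qed.

Definition preserves_DN (alpha : R) : Prop :=
  forall A : 'M[R]_n, DN A -> DN (powmx A alpha).

Definition eventually_preserving : set R :=
  [set mu | 0 <= mu /\ forall alpha, mu <= alpha -> preserves_DN alpha].

(* [mu] is the least element of the set, so its existence is part of the
   predicate. *)
Definition is_critical_exponent (mu : R) : Prop :=
  eventually_preserving mu /\ lbound eventually_preserving mu.

End DoublyNonnegative.

(* Main.v *)
Require Import Defs.
From mathcomp Require Import all_boot all_order all_algebra fingroup perm.
From mathcomp Require Import complex spectral.
From mathcomp Require Import all_classical all_reals all_analysis.
From mathcomp Require Import measurable_realfun.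
From mathcomp Require Import ring lra zify.

Set Implicit Arguments.
Unset Strict Implicit.
Unset Printing Implicit Defensive.

Import Order.TTheory GRing.Theory Num.Theory.
Import numFieldNormedType.Exports.
Local Open Scope classical_set_scope.
Local Open Scope ring_scope.

(** Natural powers of a doubly nonnegative matrix are doubly nonnegative, and
    real powers are always positive semidefinite, so only the signs of the
    entries of [A ^ alpha] for non-integral [alpha] are at stake.

    Sufficiency of [alpha >= n - 2]. Let [y 0 >= ... >= y (n - 1) >= 0] be the
    eigenvalues of [A]. The engine is a theorem of Micchelli and Willoughby: all
    the products [prod_(k < l < n) (A - y l)] over the smallest eigenvalues have
    nonnegative entries ([newton_tail_ge0]). Indeed the entries of these products
    are exactly the coefficients of the expansion, in the Newton basis with
    nodes [y], of the entries of the adjugate of [X - A]. The adjugate satisfies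
    a recursion with nonnegative coefficients that deletes rows and columns of
    [A] until characteristic polynomials of principal submatrices are left. By
    Cauchy interlacing the roots of such a polynomial, sorted, lie below the
    nodes, and this forces nonnegative Newton coefficients
    ([newton_coef_prod_ge0]).

    For [s > 0], the function [x ^ (n - 1) / (x + s)] agrees on the spectrum
    with a nonnegative combination of these products, hence
    [A ^ (n - 1) (A + s)^-1], and then [A ^ (m + 1) (A + s)^-1] for every
    [m >= n - 2], has nonnegative entries ([resolvent_power_ge0]). Finally, for
    [0 < b < 1], [x ^ b] is a positive multiple of the integral of
    [s ^ (b - 1) x / (x + s)] over [s > 0], so [A ^ (m + b)] is a positive
    combination of such matrices ([power_sum_ge0]).

    Necessity. Let [m < alpha < m + 1] with [m + 2 < n], and let [T] be the
    adjacency matrix of a path on [n] vertices. The entry of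
    [(1 + t T) ^ alpha] joining the first vertex to the vertex at distance
    [m + 2] is [binom(alpha, m + 2) t ^ (m + 2)] up to higher order terms, since
    no shorter walk joins the two vertices; the binomial coefficient is negative
    ([not_preserves_DN]). *)

(** * Newton expansions *)

Section NewtonCoefficients.
Variable F : fieldType.
Implicit Types (y : nat -> F) (p q : {poly F}) (k n : nat).

Definition newton y k : {poly F} := \prod_(l < k) ('X - (y l)%:P).

(** The divided difference of [q] at [y 0, ..., y k]. Euclidean division makes
    sense of it for repeated nodes, without derivatives. *)
Definition newton_coef y k q : F := (q %/ newton y k).[y k].

Lemma newton_neq0 y k : newton y k != 0.
Proof. by apply/prodf_neq0 => i _; rewrite polyXsubC_eq0. Qed.

Lemma newtonS y k : newton y k.+1 = newton y k * ('X - (y k)%:P).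
Proof. by rewrite /newton big_ord_recr. Qed.

Lemma newton_shift y k : newton y k.+1 = ('X - (y 0)%:P) * newton (y \o S) k.
Proof. by rewrite /newton big_ord_recl. Qed.

Lemma newton_coefD y k : {morph newton_coef y k : p q / p + q}.
Proof. by move=> p q; rewrite /newton_coef divpD hornerD. Qed.

Lemma newton_coefZ y k a : {morph newton_coef y k : p / a *: p >-> a * p}.
Proof. by move=> p; rewrite /newton_coef divpZl hornerZ. Qed.

Lemma newton_coef0 y k : newton_coef y k 0 = 0.
Proof. by rewrite /newton_coef div0p horner0. Qed.

Lemma newton_coef_sum y k (I : Type) (r : seq I) (P : pred I)
    (G : I -> {poly F}) :
  newton_coef y k (\sum_(i <- r | P i) G i) =
  \sum_(i <- r | P i) newton_coef y k (G i).
Proof. exact: (big_morph _ (newton_coefD y k) (newton_coef0 y k)). Qed.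

Lemma newton_coef1 y k : newton_coef y k 1 = (k == 0)%:R.
Proof.
case: k => [|k]; first by rewrite /newton_coef /newton big_ord0 divp1 hornerC.
rewrite /newton_coef divp_small ?horner0 // size_poly1 newton_shift.
rewrite size_Mmonic ?polyXsubC_eq0 ?newton_neq0 //; last first.
  by apply: monic_prod => i _; rewrite monicXsubC.
by rewrite size_XsubC /= ltnS size_poly_gt0 newton_neq0.
Qed.

Lemma newton_coef_mulX0 y q : newton_coef y 0 (('X - (y 0)%:P) * q) = 0.
Proof.
by rewrite /newton_coef /newton big_ord0 divp1 hornerM hornerXsubC subrr mul0r.
Qed.

Lemma newton_coef_mulXS y k q :
  newton_coef y k.+1 (('X - (y 0)%:P) * q) = newton_coef (y \o S) k q.
Proof.
by rewrite /newton_coef newton_shift divp_pmul2l ?polyXsubC_eq0 ?newton_neq0.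
Qed.

Lemma newton_coef_newton y k m : newton_coef y k (newton y m) = (k == m)%:R.
Proof.
elim: m y k => [|m IHm] y [|k]; rewrite ?newton_shift.
- by rewrite /newton big_ord0 newton_coef1.
- by rewrite /newton big_ord0 newton_coef1.
- by rewrite newton_coef_mulX0.
- by rewrite newton_coef_mulXS IHm eqSS.
Qed.

Definition newton_tail y n k (x : F) : F := \prod_(k.+1 <= l < n) (x - y l).

(** Writing [N k] and [P k] for the two factors of the summand,
    [(X - x) N_k P_k = N_(k+1) P_k - N_k P_(k-1)], and the sum telescopes. *)
Lemma newton_telescope y n (x : F) :
  ('X - x%:P) * \sum_(k < n) newton_tail y n k x *: newton y k =
  newton y n - (\prod_(l < n) (x - y l))%:P.
Proof.
have step m : (m <= n)%N ->
  ('X - x%:P) * \sum_(k < m) newton_tail y n k x *: newton y k =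
  (\prod_(m <= l < n) (x - y l)) *: newton y m - (\prod_(l < n) (x - y l))%:P.
  elim: m => [|m IHm] lemn.
    rewrite big_ord0 mulr0 big_mkord /newton big_ord0.
    by rewrite alg_polyC subrr.
  rewrite big_ord_recr /= mulrDr IHm 1?ltnW // big_ltn // newtonS.
  rewrite /newton_tail; set t := \prod_(_ <= _ < _) _.
  rewrite -!mul_polyC polyCM polyCB; ring.
by rewrite step // big_geq // scale1r.
Qed.

(** At [x = y j] the constant term of [newton_telescope] vanishes, and dividing
    by [X - y j] leaves the Newton expansion of the product on the left. *)
Lemma newton_coef_prod_neq y n (j : 'I_n) k : (k < n)%N ->
  newton_coef y k (\prod_(l < n | l != j) ('X - (y l)%:P)) =
  newton_tail y n k (y j).
Proof.
move=> ltkn; set q := \prod_(l < n | _) _.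
have -> : q = \sum_(k < n) newton_tail y n k (y j) *: newton y k.
  have /mulfI : 'X - (y j)%:P != 0 :> {poly F} by rewrite polyXsubC_eq0.
  apply; rewrite newton_telescope.
  rewrite [X in newton _ _ - X%:P](bigD1 j) //= subrr mul0r subr0.
  by rewrite /newton [RHS](bigD1 j).
rewrite newton_coef_sum (bigD1 (Ordinal ltkn)) //= big1 => [|i neqi].
  by rewrite newton_coefZ newton_coef_newton eqxx mulr1 addr0.
rewrite newton_coefZ newton_coef_newton; case: eqP => [kE|]; last by rewrite mulr0.
by case/eqP: neqi; apply/val_inj.
Qed.

End NewtonCoefficients.

Section Positivity.
Variable R : realFieldType.

(** Split off the largest root: if [g] is the product of the other factors then
    [(X - nu 0) g = (y 0 - nu 0) g + (X - y 0) g]. The first coefficient is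
    nonnegative, and the roots of [g] lie below the nodes as well as below the
    shifted nodes, which are the ones that govern [(X - y 0) g]. *)
Lemma newton_coef_prod_ge0 m (nu y : nat -> R) k :
  (forall i j, (i <= j < m)%N -> nu j <= nu i) ->
  (forall i, (i < m)%N -> nu i <= y i) ->
  0 <= newton_coef y k (newton nu m).
Proof.
elim: m nu y k => [|m IHm] nu y k nu_dec le_nu_y.
  by rewrite /newton big_ord0 newton_coef1 ler0n.
have nuS_dec : forall i j, (i <= j < m)%N -> (nu \o S) j <= (nu \o S) i.
  by move=> i j ij; apply: nu_dec.
rewrite newton_shift.
have -> : ('X - (nu 0)%:P) * newton (nu \o S) m =
    (y 0%N - nu 0%N) *: newton (nu \o S) m +
    ('X - (y 0%N)%:P) * newton (nu \o S) m.
  by rewrite -mul_polyC polyCB; ring.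
rewrite newton_coefD newton_coefZ addr_ge0 //.
  rewrite mulr_ge0 // ?subr_ge0 ?le_nu_y // IHm // => i ltim /=.
  by apply: le_trans (le_nu_y i _); [apply: nu_dec; rewrite leqnSn | apply: ltnW].
case: k => [|k]; first by rewrite newton_coef_mulX0.
by rewrite newton_coef_mulXS IHm // => i ltim; apply: le_nu_y.
Qed.

End Positivity.

(** * The spectral theorem for real symmetric matrices *)

Section RealSpectralTheorem.
Variable R : rcfType.

Lemma row_norm_gt0 n (v : 'rV[R]_n) : v != 0 -> 0 < (v *m v^T) 0 0.
Proof.
move=> v0; rewrite lt_def; apply/andP; split; last first.
  by rewrite mxE sumr_ge0 // => i _; rewrite !mxE -expr2 sqr_ge0.
apply: contraNneq v0; rewrite mxE => /eqP; rewrite psumr_eq0 => [/allP v0|i _].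
  apply/eqP/rowP => i; have := v0 i; rewrite mem_index_enum => /(_ isT) /=.
  by rewrite !mxE mulf_eq0 orbb => /eqP.
by rewrite !mxE -expr2 sqr_ge0.
Qed.

(** A complex eigenvalue exists; pairing an eigenvector with its conjugate shows
    that it is real. *)
Lemma symmetric_eigenvalue n (A : 'M[R]_n) :
  (0 < n)%N -> A^T = A -> exists a, eigenvalue A a.
Proof.
move=> n0 symA; pose f := real_complex R.
pose AC := map_mx f A.
have [a aP] := eigenvalue_closed AC n0.
suff aR : a \is Num.real.
  exists (complex.Re a); move: aP.
  by rewrite -{1}(RRe_real aR) /AC /f eigenvalue_map.
have /eigenvalueP[v vA v0] := aP.
pose vs := map_mx Num.conj v^T.
have vsA : AC *m vs = a^* *: vs.
  have ACs : map_mx Num.conj AC^T = AC.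
    apply/matrixP => i j; rewrite !mxE -[in RHS]symA mxE.
    by apply/CrealP; apply/complex_realP; exists (A j i).
  rewrite -[in LHS]ACs -map_mxM -trmx_mul vA linearZ /= /vs.
  by apply/matrixP => i j; rewrite !mxE rmorphM.
have : v *m AC *m vs = v *m (AC *m vs) by rewrite mulmxA.
rewrite vA vsA -scalemxAl -scalemxAr => /matrixP/(_ 0 0); rewrite !mxE.
set N := \sum_(_ | _) _ => aN.
suff N0 : N != 0 by apply/CrealP/(mulIf N0); rewrite aN.
apply: contraNneq v0 => /eqP; rewrite psumr_eq0 => [/allP v0|i _].
  apply/eqP/rowP => i; have := v0 i; rewrite mem_index_enum => /(_ isT) /=.
  by rewrite !mxE mul_conjC_eq0 => /eqP.
by rewrite !mxE mul_conjC_ge0.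
Qed.

(** The reflection in the hyperplane orthogonal to [v - u]. *)
Lemma householder n (u v : 'rV[R]_n) : u *m u^T = 1%:M -> v *m v^T = 1%:M ->
  exists H : 'M[R]_n, [/\ H^T = H, H *m H = 1%:M & u *m H = v].
Proof.
move=> u1 v1; have [->|neq_uv] := eqVneq u v.
  by exists 1%:M; split; rewrite ?trmx1 ?mulmx1.
pose w := v - u; pose N := (w *m w^T) 0 0.
have N0 : N != 0 by rewrite gt_eqF // row_norm_gt0 // subr_eq0 eq_sym.
have wwE : w *m w^T = N%:M by rewrite [LHS]mx11_scalar.
pose H := 1%:M - (2%:R / N) *: (w^T *m w).
exists H; split.
- by rewrite /H linearB /= trmx1 linearZ /= trmx_mul trmxK.
- have MM : w^T *m w *m (w^T *m w) = N *: (w^T *m w).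
    by rewrite mulmxA -(mulmxA w^T) wwE mul_mx_scalar scalemxAl.
  rewrite /H mulmxBr mulmx1 -scalemxAr mulmxBl mul1mx -scalemxAl MM.
  by apply/matrixP => i j; rewrite !mxE; field.
have uw : 2%:R *: (u *m w^T) = (- N)%:M.
  have vu : v *m u^T = u *m v^T.
    rewrite [LHS]mx11_scalar [RHS]mx11_scalar; congr _%:M.
    by rewrite !mxE; apply: eq_bigr => i _; rewrite !mxE mulrC.
  rewrite raddfN /= -wwE /w linearB /= !mulmxBr !mulmxBl u1 v1 vu.
  by apply/matrixP => i j; rewrite !mxE; ring.
rewrite /H mulmxBr mulmx1 -scalemxAr mulmxA scalemxAl mulrC -scalerA uw.
by rewrite scale_scalar_mx mulrN mulVf // mul_scalar_mx scaleN1r opprK addrC subrK.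
Qed.

(** Deflation: a reflection takes the first basis vector to a unit eigenvector,
    and conjugating by it makes [A] block diagonal. *)
Lemma symmetric_spectral n (A : 'M[R]_n) : A^T = A ->
  exists (U : 'M[R]_n) (d : 'rV[R]_n),
    U *m U^T = 1%:M /\ A = U *m diag_mx d *m U^T.
Proof.
elim: n A => [|n IHn] A symA.
  by exists 1%:M, 0; split; apply/matrixP => -[].
have [a /eigenvalueP[v0 v0A v0n0]] := symmetric_eigenvalue (ltn0Sn n) symA.
pose N := Num.sqrt ((v0 *m v0^T) 0 0).
have N0 : N != 0 by rewrite gt_eqF // sqrtr_gt0 row_norm_gt0.
pose v := N^-1 *: v0.
have v1 : v *m v^T = 1%:M.
  rewrite /v linearZ /= -scalemxAl -scalemxAr scalerA [_ *m _]mx11_scalar.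
  rewrite scale_scalar_mx -[X in _ * X]sqr_sqrtr ?ltW ?row_norm_gt0 // -/N.
  by congr _%:M; field.
have vA : v *m A = a *: v.
  by rewrite /v -scalemxAl v0A !scalerA mulrC.
have u1 : (delta_mx 0 0 : 'rV[R]_n.+1) *m (delta_mx 0 0)^T = 1%:M.
  rewrite trmx_delta mul_delta_mx.
  by apply/matrixP => i j; rewrite !mxE !ord1.
have [H [symH HH uH]] := householder u1 v1.
have [B BD] : exists B : 'M[R]_(1 + n), B = H *m A *m H by exists (H *m A *m H).
have symB : B^T = B by rewrite BD !trmx_mul symH symA mulmxA.
have rowB : row 0 B = a *: delta_mx 0 0.
  rewrite rowE BD !mulmxA uH vA -scalemxAl; congr (_ *: _).
  by rewrite -uH -mulmxA HH mulmx1.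
have rowB0 (j : 'I_n.+1) : B 0 j = a * (j == 0)%:R.
  by have /rowP/(_ j) := rowB; rewrite !mxE.
have [U' [d' [U'1 BE]]] : exists (U : 'M[R]_n) (d : 'rV[R]_n),
    U *m U^T = 1%:M /\ drsubmx B = U *m diag_mx d *m U^T.
  by apply: IHn; rewrite trmx_drsub symB.
have lsh0 : lshift n (0 : 'I_1) = (0 : 'I_n.+1) by apply/val_inj.
have BE' : B = block_mx a%:M 0 0 (drsubmx B).
  rewrite -[LHS]submxK; congr block_mx.
  - apply/matrixP => i j; rewrite !mxE !ord1 ?lsh0.
    by rewrite rowB0 eqxx mulr1.
  - apply/matrixP => i j; rewrite !mxE !ord1 ?lsh0.
    by rewrite rowB0 mulr0.
  - apply/matrixP => i j; rewrite !mxE !ord1 ?lsh0.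
    by rewrite -symB mxE rowB0 mulr0.
pose V : 'M[R]_(1 + n) := block_mx 1%:M 0 0 U'.
have VV : V *m V^T = 1%:M.
  rewrite /V tr_block_mx mulmx_block !trmx0 !mul0mx !mulmx0 !addr0 add0r.
  by rewrite trmx1 mulmx1 U'1 -scalar_mx_block.
have VDV : V *m diag_mx (row_mx a%:M d') *m V^T = B.
  rewrite diag_mx_row /V tr_block_mx !mulmx_block.
  rewrite !trmx0 ?(mul0mx, mulmx0) ?(mul0mx, mulmx0, addr0, add0r).
  rewrite trmx1 mulmx1 mul1mx ?(mul0mx, mulmx0, addr0, add0r).
  rewrite [RHS]BE' BE; congr block_mx.
  by apply/matrixP => i j; rewrite !mxE !ord1 eqxx.
exists (H *m V), (row_mx a%:M d'); split.
  rewrite trmx_mul symH mulmxA -(mulmxA H).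
  by have -> : V *m V^T = (1%:M : 'M[R]_n.+1) by []; rewrite mulmx1.
have HVD : H *m V *m diag_mx (row_mx a%:M d') *m (V^T *m H) = H *m B *m H.
  by rewrite -VDV !mulmxA.
rewrite trmx_mul symH; apply: etrans (esym HVD).
by rewrite BD !mulmxA HH mul1mx -mulmxA HH mulmx1.
Qed.

Lemma symmetric_spectral_sorted n (A : 'M[R]_n) : A^T = A ->
  exists (U : 'M[R]_n) (y : nat -> R),
    [/\ U *m U^T = 1%:M, A = U *m diag_mx (\row_i y i) *m U^T &
        forall i j, (i <= j < n)%N -> y j <= y i].
Proof.
move=> /symmetric_spectral[U [d [U1 AE]]].
pose t := [tuple d 0 i | i < n].
pose s := sort (>=%R) t.
have /tuple_permP[p sE] : perm_eq s t by rewrite perm_sort.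
have sizes : size s = n by rewrite size_sort size_tuple.
have sp (i : 'I_n) : s`_i = d 0 (p i).
  by rewrite sE (nth_map i) ?size_enum_ord // nth_ord_enum tnth_mktuple.
have Ps : perm_mx p *m (perm_mx p)^T = 1%:M :> 'M[R]_n.
  by rewrite tr_perm_mx -perm_mxM mulgV perm_mx1.
exists (U *m (perm_mx p)^T), (fun i => s`_i); split.
- rewrite trmx_mul trmxK mulmxA -(mulmxA U).
  rewrite tr_perm_mx -perm_mxM mulVg perm_mx1 mulmx1 //.
- rewrite AE trmx_mul trmxK !mulmxA; congr (_ *m _).
  rewrite -!mulmxA; congr (_ *m _).
  apply/matrixP => i j; rewrite tr_perm_mx.
  rewrite -[X in _ *m (_ *m perm_mx X)]invgK -col_permE -row_permE.
  rewrite !mxE sp; congr (_ *+ _).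
    by rewrite permKV.
  by rewrite (inj_eq (can_inj (permKV p))).
move=> i j /andP[leij ltjn]; have [->|neqij] := eqVneq i j; first exact: lexx.
have ge_tr : transitive (>=%R : rel R) by move=> x u z ux xz; apply: le_trans ux.
have s_sorted : sorted (>=%R) s by apply: sort_sorted => u v; apply: le_total.
apply: (sorted_ltn_nth ge_tr 0 s_sorted); rewrite ?inE ?sizes //.
  exact: leq_ltn_trans ltjn.
by rewrite ltn_neqAle neqij.
Qed.

End RealSpectralTheorem.

(** * The adjugate of the characteristic matrix *)

Section Spectrum.
Variables (R : rcfType) (n : nat) (U : 'M[R]_n) (y : nat -> R).
Hypothesis U1 : U *m U^T = 1%:M.

(** The functional calculus: when [A] is [spectral_mx U y], the matrix [f(A)]
    is [spectral_mx U (f \o y)]. *)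
Definition spectral_mx : 'M[R]_n := U *m diag_mx (\row_i y i) *m U^T.

Lemma spectral_mxE a b : spectral_mx a b = \sum_j U a j * U b j * y j.
Proof.
rewrite /spectral_mx mul_mx_diag mxE; apply: eq_bigr => j _.
by rewrite !mxE mulrAC.
Qed.

Lemma orthogonalC : U^T *m U = 1%:M. Proof. exact: mulmx1C. Qed.

Let UP := map_mx polyC U.

Lemma char_poly_mx_spectral : char_poly_mx spectral_mx =
  UP *m diag_mx (\row_i ('X - (y i)%:P)) *m UP^T.
Proof.
have UP1 : UP *m UP^T = 1%:M by rewrite /UP map_trmx -map_mxM U1 map_mx1.
rewrite /char_poly_mx /spectral_mx !map_mxM -map_trmx -/UP.
have -> : diag_mx (\row_i ('X - (y i)%:P)) =
    'X%:M - map_mx polyC (diag_mx (\row_i y i)) :> 'M[{poly R}]_n.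
  apply/matrixP => i j; rewrite !mxE.
  by case: eqP => _; rewrite ?mulr1n ?mulr0n ?rmorph0 ?subr0.
rewrite mulmxBr mulmxBl mul_mx_scalar -scalemxAl UP1.
by rewrite scale_scalar_mx mulr1.
Qed.

Lemma char_poly_spectral : char_poly spectral_mx = newton y n.
Proof.
rewrite /char_poly char_poly_mx_spectral !det_mulmx det_tr mulrAC -[RHS]mul1r.
congr (_ * _).
  have := congr1 determinant U1; rewrite det_mulmx det_tr det1 => detU.
  by rewrite /UP -expr2 det_map_mx -rmorphXn /= expr2 detU.
by rewrite det_diag; apply: eq_bigr => i _; rewrite mxE.
Qed.

(** The right-hand side multiplied by [X - A] is the characteristic polynomial,
    as is the adjugate, and polynomials form an integral domain. *)
Lemma adj_char_poly_spectral a b : (\adj (char_poly_mx spectral_mx)) a b =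
  \sum_j (U a j * U b j) *: \prod_(l < n | l != j) ('X - (y l)%:P).
Proof.
pose q (j : 'I_n) := \prod_(l < n | l != j) ('X - (y l)%:P).
pose S := UP *m diag_mx (\row_j q j) *m UP^T.
have UP1' : UP^T *m UP = 1%:M.
  by rewrite /UP map_trmx -map_mxM orthogonalC map_mx1.
have UP1 : UP *m UP^T = 1%:M by exact: mulmx1C.
have MS : char_poly_mx spectral_mx *m S = (newton y n)%:M.
  rewrite char_poly_mx_spectral /S !mulmxA -(mulmxA _ UP^T) UP1' mulmx1.
  rewrite -(mulmxA UP) mulmx_diag.
  have -> : diag_mx (\row_j ((\row_i ('X - (y i)%:P)) 0 j * (\row_j q j) 0 j)) =
     (newton y n)%:M.
    rewrite -diag_const_mx; congr diag_mx; apply/rowP => j; rewrite !mxE.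
    by rewrite /newton [RHS](bigD1 j).
  by rewrite mul_mx_scalar -scalemxAl UP1 scale_scalar_mx mulr1.
have : \adj (char_poly_mx spectral_mx) *m (char_poly_mx spectral_mx *m S) =
       \adj (char_poly_mx spectral_mx) *m char_poly_mx spectral_mx *m S.
  by rewrite mulmxA.
rewrite MS mul_adj_mx -/(char_poly _) char_poly_spectral mul_mx_scalar.
rewrite mul_scalar_mx => /matrixP/(_ a b); rewrite [LHS]mxE [RHS]mxE.
move=> /(mulfI (newton_neq0 y n)) ->; rewrite /S mul_mx_diag mxE; apply: eq_bigr => j _.
by rewrite !mxE -mul_polyC polyCM mulrAC.
Qed.

End Spectrum.

Lemma spectral_mxM (R : rcfType) n (U : 'M[R]_n) (f g : nat -> R) :
  U *m U^T = 1%:M ->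
  spectral_mx U f *m spectral_mx U g = spectral_mx U (fun i => f i * g i).
Proof.
move=> U1; rewrite /spectral_mx !mulmxA -[_ *m U^T *m U]mulmxA orthogonalC //.
rewrite mulmx1; congr (_ *m _); rewrite -mulmxA; congr (_ *m _).
by rewrite mulmx_diag; congr diag_mx; apply/rowP => i; rewrite !mxE.
Qed.

Section Adjugate.
Variables (R : idomainType) (n : nat) (A : 'M[R]_n.+1) (i : 'I_n.+1).

Definition delete_mx : 'M[R]_n := row' i (col' i A).

Lemma adj_char_poly_diag :
  (\adj (char_poly_mx A)) i i = char_poly delete_mx.
Proof.
rewrite mxE /cofactor -signr_odd oddD addbb mul1r.
by rewrite [X in \det X]row'_col'_char_poly_mx.
Qed.

(** The columns other than [i] of row [i] of [adj(X - A) (X - A) = det(X - A)]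
    form a linear system whose matrix is [X - A'], with [A'] obtained from [A]
    by deleting row and column [i]. Its right-hand side is [det(X - A')] times row
    [i] of [A], so solving it by Cramer's rule cancels the determinant. *)
Lemma adj_char_poly_off_diag j : (\adj (char_poly_mx A)) i (lift i j) =
  \sum_l (A i (lift i l))%:P * (\adj (char_poly_mx delete_mx)) l j.
Proof.
set M := char_poly_mx A; set N := char_poly_mx delete_mx.
pose r : 'rV[{poly R}]_n := \row_l (\adj M) i (lift i l).
pose m : 'rV[{poly R}]_n := \row_l M i (lift i l).
have NE : row' i (col' i M) = N by exact: row'_col'_char_poly_mx.
have rN : r *m N = - (\det N *: m).
  apply/rowP => l.
  have : (\adj M *m M) i (lift i l) = 0 by rewrite mul_adj_mx mxE eq_liftF.
  rewrite mxE (bigD1_ord i) //= addrC.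
  move/eqP; rewrite addr_eq0 adj_char_poly_diag => /eqP rE.
  rewrite [in RHS]mxE [in RHS]mxE [m _ _]mxE -rE mxE; apply: eq_bigr => k _.
  by rewrite -NE !mxE.
have : r *m (N *m \adj N) = r *m N *m \adj N by rewrite mulmxA.
rewrite mul_mx_adj rN mul_mx_scalar mulNmx -scalemxAl -scalerN.
have N0 : \det N != 0 by exact/monic_neq0/char_poly_monic.
move=> /rowP/(_ j); rewrite [LHS]mxE [RHS]mxE => /(mulfI N0); rewrite mxE => ->.
rewrite mxE mxE -sumrN; apply: eq_bigr => l _; rewrite !mxE eq_liftF mulr0n sub0r.
by rewrite mulNr opprK.
Qed.

End Adjugate.

(** * Min-max domination and the Micchelli-Willoughby theorem *)

Section Domination.
Variable R : rcfType.

(** One half of the min-max principle: the [k]-th largest eigenvalue of [A],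
    counted from [0], is at most [y k]. In terms of linear constraints rather than eigenvalues it passes
    to principal submatrices at once. *)
Definition dominates n (y : nat -> R) (A : 'M[R]_n) : Prop :=
  forall k, (k < n)%N -> exists C : 'M[R]_(n, k), forall x : 'rV[R]_n,
    x *m C = 0 -> (x *m A *m x^T) 0 0 <= y k * (x *m x^T) 0 0.

Lemma quad_diag n (d x : 'rV[R]_n) :
  (x *m diag_mx d *m x^T) 0 0 = \sum_i d 0 i * x 0 i ^+ 2.
Proof.
by rewrite mul_mx_diag mxE; apply: eq_bigr => i _; rewrite !mxE; ring.
Qed.

Lemma quad_sum n (x : 'rV[R]_n) : (x *m x^T) 0 0 = \sum_i x 0 i ^+ 2.
Proof. by rewrite mxE; apply: eq_bigr => i _; rewrite !mxE. Qed.

(** Extend a vector by [0] at the deleted index. *)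
Lemma dominates_delete n (y : nat -> R) (A : 'M[R]_n.+1) i :
  dominates y A -> dominates y (delete_mx A i).
Proof.
move=> domA k ltkn; have [C domC] := domA k (ltnW ltkn).
exists (row' i C) => x xC0.
pose z : 'rV[R]_n.+1 := \row_j oapp (x 0) 0 (unlift i j).
have zi : z 0 i = 0 by rewrite mxE unlift_none.
have zl j : z 0 (lift i j) = x 0 j by rewrite mxE liftK.
have sum_z m (B : 'M[R]_(n.+1, m)) : z *m B = x *m row' i B.
  apply/matrixP => a b; rewrite !ord1 !mxE (bigD1_ord i) //= zi mul0r add0r.
  by apply: eq_bigr => j _; rewrite zl !mxE.
have := domC z; rewrite !sum_z => /(_ xC0).
have -> : row' i z^T = x^T by apply/matrixP => a b; rewrite mxE mxE !ord1 zl mxE.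
suff -> : x *m row' i A *m z^T = x *m delete_mx A i *m x^T by [].
apply/matrixP => a b; rewrite !ord1 mxE [RHS]mxE (bigD1_ord i) //=.
rewrite [z^T _ _]mxE zi mulr0 add0r; apply: eq_bigr => j _.
rewrite [z^T _ _]mxE zl [x^T _ _]mxE; congr (_ * _).
by rewrite !mxE; apply: eq_bigr => l _; rewrite !mxE.
Qed.

Lemma dominates_spectral n (U : 'M[R]_n) (y : nat -> R) :
  U *m U^T = 1%:M -> (forall i j, (i <= j < n)%N -> y j <= y i) ->
  dominates y (spectral_mx U y).
Proof.
move=> U1 y_dec k ltkn.
exists (U *m \matrix_(i, j) (i == j :> nat)%:R) => x; rewrite mulmxA.
rewrite /spectral_mx; set z := x *m U => zC0.
have -> : x *m (U *m diag_mx (\row_i y i) *m U^T) *m x^T =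
          z *m diag_mx (\row_i y i) *m z^T by rewrite /z trmx_mul !mulmxA.
have -> : x *m x^T = z *m z^T by rewrite /z trmx_mul !mulmxA -(mulmxA x) U1 mulmx1.
clearbody z; rewrite quad_diag quad_sum mulr_sumr.
apply: ler_sum => i _; rewrite mxE.
have [ltik|leki] := ltnP i k; last first.
  by rewrite ler_wpM2r ?sqr_ge0 // y_dec // leki ltn_ord.
have /rowP/(_ (Ordinal ltik)) := zC0.
rewrite !mxE (bigD1 i) //= big1 => [|l neqli]; last first.
  by rewrite mxE /= -[_ == _ :> nat]/(l == i) (negPf neqli) mulr0.
by rewrite mxE eqxx mulr1 addr0 => ->; rewrite expr0n !mulr0.
Qed.

(** The first [k + 1] eigenvectors span a space on which the quadratic form is
    at least [nu k] times the square of the norm, and [k] linear constraints leave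
    a nonzero vector in it. *)
Lemma dominates_eigenvalue n (U : 'M[R]_n) (nu y : nat -> R) k :
  U *m U^T = 1%:M -> (forall i j, (i <= j < n)%N -> nu j <= nu i) ->
  dominates y (spectral_mx U nu) -> (k < n)%N -> nu k <= y k.
Proof.
move=> U1 nu_dec dom ltkn; have [C domC] := dom k ltkn.
pose E : 'M[R]_(k.+1, n) := \matrix_(i, j) (i == j :> nat)%:R.
have [c c0 cEC] : exists2 c : 'rV[R]_k.+1, c != 0 & c *m (E *m U^T *m C) = 0.
  have /rowV0Pn[c /sub_kermxP cK c0] : kermx (E *m U^T *m C) != 0.
    by rewrite -mxrank_eq0 mxrank_ker subn_eq0 -ltnNge ltnS rank_leq_col.
  by exists c.
pose z := c *m E.
have zE (i : 'I_k.+1) (j : 'I_n) : i = j :> nat -> z 0 j = c 0 i.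
  move=> eij; rewrite mxE (bigD1 i) //= mxE eij eqxx mulr1 big1 ?addr0 // => l.
  by move=> /negPf neq; rewrite mxE -eij val_eqE neq mulr0.
have z0 (j : 'I_n) : (k < j)%N -> z 0 j = 0.
  move=> ltkj; rewrite mxE big1 // => l _; rewrite mxE ltn_eqF ?mulr0 //.
  by apply: leq_ltn_trans ltkj; rewrite -ltnS.
have zn0 : z != 0.
  apply: contraNneq c0 => z_eq0; apply/eqP/rowP => i.
  have lti : (i < n)%N by apply: leq_trans (ltn_ord i) ltkn.
  by rewrite -(zE i (Ordinal lti)) // z_eq0 !mxE.
have UU := orthogonalC U1.
have zz : z *m U^T *m (U *m z^T) = z *m z^T.
  by rewrite mulmxA -(mulmxA z) UU mulmx1.
have zAz : z *m U^T *m spectral_mx U nu *m (U *m z^T) =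
    z *m diag_mx (\row_i nu i) *m z^T.
  rewrite /spectral_mx !mulmxA -(mulmxA z) UU mulmx1.
  by rewrite -[_ *m U^T *m U]mulmxA UU mulmx1.
have zC0 : z *m U^T *m C = 0 by rewrite -[RHS]cEC /z !mulmxA.
have := domC _ zC0; rewrite trmx_mul trmxK zz zAz => le_dom.
rewrite -(ler_pM2r (row_norm_gt0 zn0)); apply: le_trans le_dom.
clearbody z; rewrite quad_diag quad_sum mulr_sumr.
apply: ler_sum => i _; rewrite mxE.
have [leik|ltki] := leqP i k; last by rewrite z0 // expr0n !mulr0.
by rewrite ler_wpM2r ?sqr_ge0 // nu_dec // leik ltkn.
Qed.

End Domination.

Section MicchelliWilloughby.
Variable R : rcfType.

(** Off the diagonal the adjugate of [X - A] is a nonnegative combination of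
    entries of the adjugate of a smaller matrix; on the diagonal it is the
    characteristic polynomial of that matrix, whose roots are dominated by
    the nodes. Both cases keep the nodes fixed. *)
Lemma newton_coef_adj_ge0 n (A : 'M[R]_n) (y : nat -> R) :
  A^T = A -> (forall i j, 0 <= A i j) -> dominates y A ->
  forall i j k, 0 <= newton_coef y k ((\adj (char_poly_mx A)) i j).
Proof.
elim: n A => [|n IHn] A symA A_ge0 domA i j k; first by case: i.
pose B := delete_mx A i.
have symB : B^T = B by apply/matrixP => a b; rewrite !mxE -[in LHS]symA mxE.
have B_ge0 a b : 0 <= B a b by rewrite !mxE.
have domB : dominates y B by exact: dominates_delete.
case: (unliftP i j) => [l|] ->; last first.
  have [U [nu [U1 BE nu_dec]]] := symmetric_spectral_sorted symB.
  rewrite adj_char_poly_diag -/B BE -/(spectral_mx U nu) char_poly_spectral //.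
  apply: newton_coef_prod_ge0 => // a ltan.
  by apply: (dominates_eigenvalue U1 nu_dec _ ltan); rewrite /spectral_mx -BE.
rewrite adj_char_poly_off_diag newton_coef_sum sumr_ge0 // => m _.
by rewrite mul_polyC newton_coefZ mulr_ge0 // IHn.
Qed.

(** The Micchelli-Willoughby theorem. When the nodes are the eigenvalues of [A],
    the entries in question are, by [newton_coef_prod_neq], the Newton
    coefficients of the entries of the adjugate of [X - A]. *)
Theorem newton_tail_ge0 n (U : 'M[R]_n) (y : nat -> R) :
  U *m U^T = 1%:M -> (forall i j, (i <= j < n)%N -> y j <= y i) ->
  (forall i j, 0 <= spectral_mx U y i j) ->
  forall a b k, (k < n)%N ->
  0 <= spectral_mx U (fun j => newton_tail y n k (y j)) a b.
Proof.
move=> U1 y_dec A_ge0 a b k ltkn.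
have symA : (spectral_mx U y)^T = spectral_mx U y.
  by rewrite /spectral_mx !trmx_mul trmxK tr_diag_mx mulmxA.
have := newton_coef_adj_ge0 symA A_ge0 (dominates_spectral U1 y_dec) a b k.
rewrite adj_char_poly_spectral // newton_coef_sum spectral_mxE.
by under eq_bigr => j _ do rewrite newton_coefZ newton_coef_prod_neq //.
Qed.

End MicchelliWilloughby.

(** * Nonnegativity of powers times resolvents *)

Section Resolvent.
Variable R : rcfType.

(** Multiply the identity for [m] by [X], and use
    [X N_i = N_(i+1) + la_i N_i] in the sum and
    [X N_m = s / (s + la_m) N_(m+1) + la_m / (s + la_m) (X + s) N_m] in the
    remainder: every coefficient created is nonnegative. *)
Lemma monomial_newton_expansion (la : nat -> R) (s : R) m :
  0 < s -> (forall l, 0 <= la l) ->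
  exists (c : nat -> R) (mu : R), [/\ forall i, 0 <= c i, 0 <= mu &
    'X^m = ('X + s%:P) * \sum_(i < m) c i *: newton la i + mu *: newton la m].
Proof.
move=> s0 la0; elim: m => [|m [c [mu [c0 mu0 XmE]]]].
  exists (fun=> 0), 1; split; rewrite ?ler01 // big_ord0 mulr0 add0r scale1r.
  by rewrite /newton big_ord0 expr0.
have sla0 : 0 < s + la m by rewrite ltr_wpDr.
(* [d m * la m] is the coefficient of [(X + s) N_m] split off from the
   remainder. *)
pose d i := if i == m then mu / (s + la m) else c i.
have d0 i : 0 <= d i by rewrite /d; case: ifP => // _; rewrite divr_ge0 // ltW.
exists (fun i => (if i is j.+1 then c j else 0) + d i * la i), (mu * s / (s + la m)).
split=> [i||].
- by rewrite addr_ge0 ?mulr_ge0 //; case: i.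
- by rewrite divr_ge0 ?mulr_ge0 // ltW.
rewrite exprS XmE.
under [in RHS]eq_bigr do rewrite scalerDl.
rewrite big_split /= big_ord_recl /= scale0r add0r big_ord_recr /=.
rewrite [d m]/d eqxx.
under [\sum_(i < m) (d _ * _) *: _]eq_bigr => i _.
  rewrite /d ltn_eqF // mulrC -scalerA; over.
under [\sum_(i < m) c i *: newton la (bump 0 i)]eq_bigr => i _.
  rewrite /bump /= add1n newtonS; over.
rewrite newtonS.
have -> : 'X * (('X + s%:P) * (\sum_(i < m) c i *: newton la i) + mu *: newton la m) =
  ('X + s%:P) * (\sum_(i < m) c i *: ('X * newton la i)) + 'X * (mu *: newton la m).
  rewrite mulrDr; congr (_ + _); rewrite mulrCA; congr (_ * _).
  by rewrite mulr_sumr; apply: eq_bigr => i _; rewrite scalerAr.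
have -> : \sum_(i < m) c i *: ('X * newton la i) =
  \sum_(i < m) c i *: (newton la i * ('X - (la i)%:P)) +
  \sum_(i < m) la i *: (c i *: newton la i).
  rewrite -big_split /=; apply: eq_bigr => i _.
  rewrite [la i *: _]scalerA [la i * _]mulrC -scalerA -scalerDr; congr (_ *: _).
  by rewrite -mul_polyC; ring.
set t := mu / (s + la m).
have muE : mu = t * (s + la m) by rewrite /t divfK // gt_eqF.
have -> : mu * s / (s + la m) = t * s by rewrite /t mulrAC.
rewrite muE -!mul_polyC !polyCM polyCD; ring.
Qed.

(** In increasing order of the eigenvalues, the products of the
    Micchelli-Willoughby theorem are Newton polynomials. *)
Lemma newton_tail_rev (y : nat -> R) n m x : (m < n)%N ->
  (newton (fun l => y (n.-1 - l)%N) m).[x] = newton_tail y n (n.-1 - m) x.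
Proof.
move=> ltmn; rewrite /newton horner_prod /newton_tail.
rewrite -(big_mkord xpredT (fun l => ('X - (y (n.-1 - l)%N)%:P).[x])) big_nat_rev /=.
set p := (n.-1 - m).+1; have pE : (n - p)%N = m by rewrite /p; lia.
have -> : \prod_(p <= l < n) (x - y l) = \prod_(0 <= l < m) (x - y (l + p)%N).
  by rewrite -{1}[p]add0n big_addn pE.
rewrite !big_mkord; apply: eq_bigr => i _.
by rewrite hornerXsubC; congr (_ - y _); have := ltn_ord i; rewrite /p; lia.
Qed.

(** The case [m = n], where the size of the matrix is [n + 1], comes from
    [monomial_newton_expansion] divided by [X + s]; larger exponents follow by
    multiplication by [A]. *)
Lemma resolvent_power_ge0 n (U : 'M[R]_n.+1) (y : nat -> R) (s : R) m :
  U *m U^T = 1%:M -> (forall i j, (i <= j <= n)%N -> y j <= y i) ->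
  (forall i, (i <= n)%N -> 0 <= y i) ->
  (forall i j, 0 <= spectral_mx U y i j) -> 0 < s -> (n <= m)%N ->
  forall a b, 0 <= spectral_mx U (fun j => y j ^+ m / (y j + s)) a b.
Proof.
move=> U1 y_dec y0 A_ge0 s0 /subnKC <-; elim: (m - n)%N => [|d IHd] a b; last first.
  have -> : spectral_mx U (fun j => y j ^+ (n + d.+1) / (y j + s)) =
      spectral_mx U y *m spectral_mx U (fun j => y j ^+ (n + d) / (y j + s)).
    rewrite spectral_mxM // /spectral_mx; congr (_ *m diag_mx _ *m _).
    by apply/rowP => i; rewrite !mxE addnS exprS mulrA.
  by rewrite mxE sumr_ge0 // => i _; rewrite mulr_ge0 // IHd.
rewrite addn0.
pose la l := y (n - l)%N.
have la0 l : 0 <= la l by rewrite y0 // leq_subr.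
have [c [mu [c0 mu0 XnE]]] := monomial_newton_expansion n s0 la0.
pose G k := spectral_mx U (fun j => newton_tail y n.+1 k (y j)).
have G0 k : (k < n.+1)%N -> 0 <= G k a b.
  by move=> ltkn; apply: newton_tail_ge0.
suff -> : spectral_mx U (fun j => y j ^+ n / (y j + s)) a b =
    \sum_(i < n) c i * G (n - i)%N a b + mu / (y 0%N + s) * G 0%N a b.
  apply: addr_ge0; last first.
    by rewrite mulr_ge0 ?G0 // divr_ge0 // addr_ge0 ?y0 // ltW.
  by apply: sumr_ge0 => i _; rewrite mulr_ge0 // G0 // ltnS leq_subr.
rewrite /G spectral_mxE. rewrite  [X in _ + _ * X]spectral_mxE mulr_sumr.
under [\sum_(i < n) _]eq_bigr do rewrite spectral_mxE mulr_sumr.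
rewrite exchange_big -big_split /=. apply: eq_bigr => j _.
have yjs : y j + s != 0 by rewrite gt_eqF // ltr_wpDl ?y0 // -ltnS.
have y0s : y 0%N + s != 0 by rewrite gt_eqF // ltr_wpDl ?y0.
pose E := \sum_(i < n) (c i *: newton la i).[y j].
have XnEj : y j ^+ n = (y j + s) * E + mu * (newton la n).[y j].
  by have /(congr1 (horner^~ (y j))) := XnE; rewrite !hornerE horner_sum.
(* This product vanishes at every eigenvalue other than the largest one, so the
   remainder may be divided by [y 0 + s] instead of [y j + s]. *)
have tail0 : newton_tail y n.+1 0 (y j) / (y j + s) =
             newton_tail y n.+1 0 (y j) / (y 0%N + s).
  have [->//|j0] := eqVneq (j : nat) 0%N.
  suff -> : newton_tail y n.+1 0 (y j) = 0 by rewrite !mul0r.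
  rewrite /newton_tail (bigD1_seq (val j)) ?iota_uniq ?mem_index_iota ?lt0n ?j0 //=.
  by rewrite subrr mul0r.
have -> : y j ^+ n / (y j + s) = E + mu * ((newton la n).[y j] / (y j + s)).
  by rewrite XnEj; field.
have laE i : (i <= n)%N -> (newton la i).[y j] = newton_tail y n.+1 (n - i) (y j).
  exact: (@newton_tail_rev y n.+1).
rewrite laE // subnn tail0 [LHS]mulrDr; congr (_ + _); last by ring.
  rewrite mulr_sumr; apply: eq_bigr => i _.
  by rewrite hornerZ laE 1?ltnW //; ring.
Qed.

End Resolvent.

(** * Fractional powers from resolvents *)

Section PowersFromResolvents.
Variable R : realType.

Lemma derive_ge0_nondecreasing_pos (f df : R -> R) :
  (forall z : R, 0 < z -> is_derive z 1 f (df z)) -> (forall z, 0 < z -> 0 <= df z) ->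
  forall x y, 0 < x -> x <= y -> f x <= f y.
Proof.
move=> fdf df0 x y x0; rewrite le_eqVlt => /predU1P[->//|ltxy].
have pos z : z \in `[x, y] -> 0 < z.
  by rewrite in_itv /= => /andP[xz _]; apply: lt_le_trans xz.
have [z|/=|z zxy] := MVT (f := f) (df := df) ltxy.
- by rewrite in_itv /= => /andP[xz _]; apply: fdf; apply: lt_trans xz.
- apply: derivable_within_continuous => z /pos z0.
  by have [] := fdf z z0.
rewrite -subr_ge0 => ->; rewrite mulr_ge0 ?subr_ge0 ?(ltW ltxy) // df0 // pos //.
by apply: subset_itv_oo_cc.
Qed.

Variable g : R.
Hypothesis g1 : 1 < g.

(** Substituting [s = z ^ g] with [g = 1 / b] turns the singular integrand
    [s ^ (b - 1) x / (x + s)] into [b^-1] times [kern (z / x ^ b)], which is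
    bounded near [z = 0]. *)
Definition kern (r : R) : R := (1 + r `^ g)^-1.

Lemma kern_gt0 r : 0 < kern r.
Proof. by rewrite invr_gt0 ltr_wpDr ?powR_ge0. Qed.

Lemma kern_le1 r : kern r <= 1.
Proof. by rewrite invf_le1 ?lerDl ?ltr_wpDr ?powR_ge0. Qed.

Lemma kern_integrable (z : R) :
  lebesgue_measure.-integrable `[0, z] (EFin \o kern).
Proof.
apply: measurable_bounded_integrable => //=.
- by rewrite lebesgue_measure_itv /=; case: ifP => // _; rewrite -EFinD ltry.
- apply: measurable_funTS.
  have -> : kern = (@powR R ^~ (-1)) \o (fun r => 1 + r `^ g).
    by apply/funext => r /=; rewrite powR_inv1 // addr_ge0 ?powR_ge0.
  apply: measurableT_comp; first exact: measurable_powR.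
  by apply: measurable_funD => //; exact: measurable_powR.
- exists 1; split => // M M1 x _ /=; rewrite gtr0_norm ?kern_gt0 //.
  by apply: le_trans (kern_le1 _) (ltW M1).
Qed.

Definition kernI (z : R) : R := \int[lebesgue_measure]_(t in `[0, z]) kern t.

Lemma kern_continuous z : 0 < z -> {for z, continuous kern}.
Proof.
move=> z0; apply: cvgV; first by rewrite gt_eqF // ltr_wpDr ?powR_ge0.
apply: cvgD; first exact: cvg_cst.
have : {for z, continuous (@powR R ^~ g)}.
  apply: differentiable_continuous; apply/derivable1_diffP.
  by apply: derivable_powR; rewrite in_itv /= z0.
exact.
Qed.

Lemma is_derive_kernI (z : R) : 0 < z -> is_derive z 1 kernI (kern z).
Proof.
move=> z0; have [] := continuous_FTC1 (f := kern) (a := BLeft 0) (x := z) (u := z + 1).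
- by rewrite ltrDl.
- exact: kern_integrable.
- by rewrite /= ?bnd_simp ?lte_fin.
- exact: kern_continuous.
by move=> dK; rewrite derive1E => <-; apply/derivableP.
Qed.

Lemma kernI_ge0 z : 0 <= kernI z.
Proof. by apply: Rintegral_ge0 => x _; rewrite ltW // kern_gt0. Qed.

Lemma kernI_le z : 0 < z -> kernI z <= z.
Proof.
move=> z0.
have zE : \int[lebesgue_measure]_(t in `[0, z]) (cst 1 t) = z.
  by rewrite Rintegral_cst //= lebesgue_measure_itv /= lte_fin z0 /= mul1r subr0.
rewrite -[leRHS]zE; apply: le_Rintegral => //.
- exact: kern_integrable.
- apply: measurable_bounded_integrable => //=.
    by rewrite lebesgue_measure_itv /=; case: ifP => // _; rewrite -EFinD ltry.
  by exists 1; split => // M M1 x _ /=; rewrite normr1 ltW.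
- by move=> x _; apply: kern_le1.
Qed.

Lemma kernI_nondecreasing x y : 0 < x -> x <= y -> kernI x <= kernI y.
Proof.
apply: (@derive_ge0_nondecreasing_pos kernI kern) => z z0.
  exact: is_derive_kernI.
exact/ltW/kern_gt0.
Qed.

(** Compare with the primitive of [z ^ - g], which is integrable at infinity. *)
Lemma kernI_bounded z : 1 <= z -> kernI z <= 1 + (g - 1)^-1.
Proof.
move=> z1.
pose G := fun z => - kernI z - (g - 1)^-1 * z `^ (1 - g).
have /(_ 1 z ltr01 z1) : forall x y, 0 < x -> x <= y -> G x <= G y.
  apply: (@derive_ge0_nondecreasing_pos G (fun z => - kern z + z `^ (- g))).
    move=> x x0; rewrite /G.
    have dK := is_derive_kernI x0.
    have dP := is_derive1_powR (1 - g) x0.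
    have -> : - kern x + x `^ (- g) =
        - kern x - (g - 1)^-1 *: ((1 - g) * x `^ (1 - g - 1)).
      have -> : 1 - g - 1 = - g by ring.
      have gn1 : g - 1 != 0 by rewrite gt_eqF // subr_gt0.
      by rewrite /GRing.scale /= -(opprB g 1) mulNr mulrN opprK mulKf.
    exact: (is_deriveB (is_deriveN dK) (is_deriveZ (g - 1)^-1 dP)).
  move=> x x0; rewrite addrC subr_ge0 /kern powRN lef_pV2 ?posrE ?powR_gt0 //.
    by rewrite lerDr.
  by rewrite ltr_wpDr ?powR_ge0.
rewrite /G powR1 => le1.
have := kernI_le ltr01; have : 0 <= (g - 1)^-1 * z `^ (1 - g).
  by rewrite mulr_ge0 ?powR_ge0 // invr_ge0 subr_ge0 ltW.
by lra.
Qed.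

Lemma kernI_le0 z : z <= 0 -> kernI z = 0.
Proof.
rewrite le_eqVlt /kernI => /predU1P[->|z0].
  by rewrite set_itv1 Rintegral_set1.
by rewrite set_itv_ge ?Rintegral_set0 // bnd_simp -ltNge.
Qed.

Lemma kernI_cvg : exists2 L : R, 0 < L & kernI z @[z --> +oo] --> L.
Proof.
have K_nd : {homo kernI : x y / x <= y}.
  move=> x y lexy; have [x0|x0] := leP x 0; last exact: kernI_nondecreasing.
  by rewrite [leLHS]kernI_le0 // kernI_ge0.
have K_bnd z : kernI z <= 1 + (g - 1)^-1.
  have [z1|/ltW z1] := leP 1 z; first exact: kernI_bounded.
  exact: le_trans (K_nd _ _ z1) (kernI_bounded (lexx 1)).
have K_ub : has_ubound (range kernI) by exists (1 + (g - 1)^-1) => _ [z _ <-].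
exists (sup (range kernI)); last exact: nondecreasing_cvgr.
suff K1 : 2^-1 <= kernI 1.
  by apply: lt_le_trans (_ : kernI 1 <= _); [lra | apply: ub_le_sup => //; exists 1].
have <- : \int[lebesgue_measure]_(t in `[0, 1]) (cst 2^-1 t) = 2^-1 :> R.
  by rewrite Rintegral_cst //= lebesgue_measure_itv /= lte_fin ltr01 /= subr0 mulr1.
apply: le_Rintegral => //; last 1 first.
- move=> r; rewrite /= in_itv /= => /andP[r0 r1].
  rewrite /kern lef_pV2 ?posrE ?ltr_wpDr ?powR_ge0 //.
  have : r `^ g <= 1 `^ g by rewrite ge0_ler_powR ?nnegrE // ltW // (lt_trans ltr01 g1).
  by rewrite powR1; lra.
- apply: measurable_bounded_integrable => //=.
    by rewrite lebesgue_measure_itv /=; case: ifP => // _; rewrite -EFinD ltry.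
  exists 1; split => // M M1 x _ /=; rewrite ger0_norm ?invr_ge0 ?ler0n //.
  apply: le_trans (ltW M1); rewrite invf_le1 ?ler1n ?ltr0n //.
- exact: kern_integrable.
Qed.

End PowersFromResolvents.

(** Let [c j = x j ^ b] and let [K] be the primitive of [kern] that vanishes at
    [0]. The function [Psi z = sum_j w j c j K (z / c j)] has the derivative
    [sum_j w j x j / (x j + z ^ (1 / b)) >= 0] and tends to [0] at [0], so it
    is nonnegative; at infinity it tends to a positive multiple of
    [sum_j w j c j]. *)
Lemma power_sum_ge0 (R : realType) n (w x : 'I_n -> R) (b : R) :
  0 < b < 1 -> (forall j, 0 <= x j) ->
  (forall s, 0 < s -> 0 <= \sum_j w j * (x j / (x j + s))) ->
  0 <= \sum_j w j * x j `^ b.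
Proof.
move=> /andP[b0 b1] x0 res_ge0.
have g1 : 1 < b^-1 by rewrite invf_gt1.
set g := b^-1 in g1.
have bg : b * g = 1 by rewrite divff // gt_eqF.
pose c j := x j `^ b.
have c0 j : 0 <= c j by exact: powR_ge0.
pose K := kernI g.
pose Psi z := \sum_j w j * c j * K (z / c j).
have dPsi (z : R) : 0 < z ->
    is_derive z 1 Psi (\sum_j w j * (x j / (x j + z `^ g))).
  move=> z0; have -> : Psi = \sum_j (fun z => w j * c j * K (z / c j)).
    by rewrite fct_sumE.
  apply: is_derive_sum => j.
  have [xj0|xjn0] := eqVneq (x j) 0.
    rewrite /c xj0 powR0 ?gt_eqF // mul0r !mulr0.
    have -> : (fun z0 => 0 * K (z0 / 0)) = cst (0 : R) by apply/funext=> u; rewrite mul0r.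
    exact: is_derive_cst.
  have xj0 : 0 < x j by rewrite lt_def xjn0 x0.
  have cj0 : 0 < c j by rewrite powR_gt0.
  have zc0 : 0 < z / c j by rewrite divr_gt0.
  have dK := is_derive_kernI g zc0.
  have dlin : is_derive z 1 (fun u => u / c j) ((c j)^-1).
    have -> : (fun u => u / c j) = (c j)^-1 *: (@id R).
      by apply/funext => u; rewrite fctE /= mulrC.
    by apply: is_derive_eq; rewrite /GRing.scale /= mulr1.
  have dKc := is_derive1_comp (f := kernI g) (g := fun u => u / c j) (x := z) dK dlin.
  have -> : (fun u => w j * c j * K (u / c j)) = 
      (w j * c j) *: (kernI g \o (fun u => u / c j)) by [].
  have powc : (z / c j) `^ g = z `^ g / x j.
    rewrite powRM ?invr_ge0 ?(ltW z0) ?(ltW cj0) //; congr (_ * _).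
    by rewrite -powR_inv1 ?ltW // -powRrM mulN1r powRN /c -powRrM bg powRr1.
  have zg0 : 0 < z `^ g by rewrite powR_gt0.
  have -> : w j * (x j / (x j + z `^ g)) =
      (w j * c j) *: (kern g (z / c j) * (c j)^-1).
    rewrite /GRing.scale /= /kern powc; field.
    by rewrite !gt_eqF // addr_gt0.
  exact: (is_deriveZ (w j * c j) dKc).
have Psi_ge0 z : 0 < z -> 0 <= Psi z.
  move=> z0; rewrite leNgt; apply/negP => Psi_lt0.
  pose W := \sum_j `|w j|.
  have W0 : 0 <= W by rewrite sumr_ge0.
  (* [z1] is so small that [|Psi z1| <= z1 W] contradicts [Psi z1 <= Psi z]. *)
  pose z1 := Num.min z (- Psi z / (W + 1) / 2).
  have z10 : 0 < z1.
    by rewrite lt_min z0 /= !divr_gt0 ?oppr_gt0 // ltr_wpDl.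
  have : Psi z1 <= Psi z.
    apply: (derive_ge0_nondecreasing_pos dPsi) => //.
      by move=> u u0; apply: res_ge0; rewrite powR_gt0.
    by rewrite ge_min lexx.
  have : - (z1 * W) <= Psi z1.
    rewrite /W mulr_sumr -sumrN; apply: ler_sum => j _.
    have [T0 Tz] : 0 <= c j * K (z1 / c j) /\ c j * K (z1 / c j) <= z1.
      split; first by rewrite mulr_ge0 // kernI_ge0.
      have [->|cn0] := eqVneq (c j) 0; first by rewrite mul0r ltW.
      have cj0 : 0 < c j by rewrite lt_def cn0 c0.
      by rewrite -ler_pdivlMl // [_^-1 * _]mulrC kernI_le // divr_gt0.
    rewrite -mulrA -mulrN mulrC; set T := c j * _ in T0 Tz *.
    have : `|w j| * T <= `|w j| * z1 by rewrite ler_wpM2l.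
    have : - `|w j| * T <= w j * T by rewrite ler_wpM2r // lerNnormlW.
    rewrite mulNr; lra.
  have : z1 * W <= - Psi z / 2.
    have : z1 * (W + 1) <= - Psi z / 2.
      by rewrite -ler_pdivlMr ?ltr_wpDl // mulrAC ge_min lexx orbT.
    rewrite mulrDr mulr1; lra.
  lra.
have [L L0 KL] := kernI_cvg g1.
suff : 0 <= \sum_j w j * c j * L.
  by rewrite -mulr_suml pmulr_lge0.
apply: (@cvgr_to_ge _ (pinfty_nbhs R) _ _ Psi).
  apply: cvg_big => [|j _]; first exact: add_continuous.
  have [->|cn0] := eqVneq (c j) 0.
    by rewrite mulr0 mul0r; under eq_fun do rewrite mul0r; exact: cvg_cst.
  have cj0 : 0 < c j by rewrite lt_def cn0 c0.
  apply: cvgM; first exact: cvg_cst.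
  apply: (cvg_comp (fun z => z / c j) K _ KL).
  by apply: gt0_cvgMly; rewrite ?invr_gt0.
by near=> z; apply: Psi_ge0; near: z; apply: nbhs_pinfty_gt.
Unshelve. all: by end_near.
Qed.

(** * Powers that preserve double nonnegativity *)

Lemma natural_part (R : realType) (a : R) :
  0 <= a -> (exists k : nat, a = k%:R) \/
  exists m : nat, m%:R < a < m.+1%:R.
Proof.
move=> /truncn_itv /andP[]; rewrite le_eqVlt => /predU1P[<- _|lt1 lt2].
  by left; exists (Num.truncn a).
by right; exists (Num.truncn a); rewrite lt1 lt2.
Qed.

Section Powers.
Variables (R : realType) (n : nat).
Implicit Types (U : 'M[R]_n) (y : nat -> R).

Lemma powmx_spectral U y (a : R) : U *m U^T = 1%:M ->
  powmx (spectral_mx U y) a = spectral_mx U (fun i => y i `^ a).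
Proof.
move=> U1; rewrite (powmxE (Ud := (U, \row_i y i))) /powmx_of /spectral_mx.
  by congr (_ *m diag_mx _ *m _); apply/rowP => i; rewrite !mxE.
by split=> //; split=> //=; apply: mulmx1C.
Qed.

Lemma spectral_possemidef U y : (forall i, (i < n)%N -> 0 <= y i) ->
  possemidef (spectral_mx U y).
Proof.
move=> y0; split; first by rewrite /spectral_mx !trmx_mul trmxK tr_diag_mx mulmxA.
move=> x; rewrite /spectral_mx.
have -> : x^T *m (U *m diag_mx (\row_i y i) *m U^T) *m x =
    (x^T *m U) *m diag_mx (\row_i y i) *m (x^T *m U)^T.
  by rewrite trmx_mul trmxK !mulmxA.
rewrite quad_diag sumr_ge0 // => i _; rewrite mulr_ge0 ?sqr_ge0 //.
by rewrite mxE y0.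
Qed.

Lemma possemidef_spectral U y : U *m U^T = 1%:M ->
  possemidef (spectral_mx U y) -> forall i, (i < n)%N -> 0 <= y i.
Proof.
move=> U1 [_ psd] i ltin; have /= := psd (U *m delta_mx (Ordinal ltin) 0).
have UU : U^T *m U = 1%:M by exact: mulmx1C.
rewrite trmx_mul trmx_delta /spectral_mx.
rewrite !mulmxA -(mulmxA _ U^T U) UU mulmx1 -(mulmxA _ U^T U) UU mulmx1.
by rewrite -rowE -colE !mxE eqxx mulr1n.
Qed.

Lemma DN_spectral A : DN A -> exists U y, [/\ U *m U^T = 1%:M,
  A = spectral_mx U y, forall i j, (i <= j < n)%N -> y j <= y i &
  forall i, (i < n)%N -> 0 <= y i].
Proof.
move=> [psdA A_ge0]; have [U [y [U1 AE y_dec]]] := symmetric_spectral_sorted psdA.1.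
by exists U, y; split => //; apply: (possemidef_spectral U1); rewrite /spectral_mx -AE.
Qed.

Lemma spectral_mxX_ge0 U y k : U *m U^T = 1%:M ->
  (forall i j, 0 <= spectral_mx U y i j) ->
  forall i j, 0 <= spectral_mx U (fun l => y l ^+ k) i j.
Proof.
move=> U1 A_ge0; elim: k => [|k IHk] i j.
  rewrite /spectral_mx (_ : \row_i _ = const_mx 1); last first.
    by apply/rowP => l; rewrite !mxE expr0.
  by rewrite diag_const_mx mulmx1 U1 mxE ler0n.
have -> : spectral_mx U (fun l => y l ^+ k.+1) =
    spectral_mx U y *m spectral_mx U (fun l => y l ^+ k).
  rewrite spectral_mxM // /spectral_mx; congr (_ *m diag_mx _ *m _).
  by apply/rowP => l; rewrite !mxE exprS.
by rewrite mxE sumr_ge0 // => l _; rewrite mulr_ge0.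
Qed.

Lemma preserves_DN_nat k : preserves_DN n (k%:R : R).
Proof.
move=> A DNA; have [U [y [U1 AE _ y0]]] := DN_spectral DNA.
have pE : powmx A k%:R = spectral_mx U (fun l => y l ^+ k).
  rewrite AE powmx_spectral // /spectral_mx; congr (_ *m diag_mx _ *m _).
  by apply/rowP => l; rewrite !mxE powR_mulrn // y0.
rewrite pE; split.
  by apply: spectral_possemidef => i ltin; rewrite exprn_ge0 ?y0.
by apply: spectral_mxX_ge0 => // i j; rewrite -AE; case: DNA.
Qed.

End Powers.

(** [y ^ a = y ^ m y ^ b] with [0 < b < 1], so [power_sum_ge0] reduces the claim
    to the matrices [A ^ (m + 1) (A + s)^-1]. *)
Lemma preserves_DN_large (R : realType) n (a : R) m :
  m%:R < a < m.+1%:R -> (n <= m.+1)%N -> preserves_DN n.+1 a.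
Proof.
move=> /andP[ma am] lenm A DNA.
have [U [y [U1 AE y_dec y0]]] := DN_spectral DNA.
have a0 : 0 < a by apply: le_lt_trans ma; rewrite ler0n.
rewrite AE powmx_spectral //; split.
  by apply: spectral_possemidef => i _; exact: powR_ge0.
move=> i j; pose b := a - m%:R.
have b01 : 0 < b < 1 by rewrite /b subr_gt0 ma ltrBlDl natr1.
rewrite spectral_mxE.
have -> : \sum_l U i l * U j l * y l `^ a =
    \sum_l (U i l * U j l * y l ^+ m) * y l `^ b.
  apply: eq_bigr => l _; rewrite -[RHS]mulrA; congr (_ * _).
  rewrite -powR_mulrn ?y0 // -powRD /b; first by rewrite addrC subrK.
  by rewrite addrC subrK gt_eqF.
apply: power_sum_ge0 => [//|l|s s0]; first by rewrite y0.
have := resolvent_power_ge0 U1 y_dec y0 _ s0 lenm i j.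
rewrite spectral_mxE -AE => /(_ (proj2 DNA)).
congr (_ <= _); apply: eq_bigr => l _; rewrite exprSr; ring.
Qed.

(** * Powers that do not preserve double nonnegativity *)

(** [phi j] stands for the [j]-th derivative of [phi 0]. The mean value theorem
    carries negativity on an interval to the right of [0] from [phi k] down to
    [phi 0]. *)
Lemma taylor_negative (R : realType) (phi : nat -> R -> R) (d : R) k :
  0 < d ->
  (forall j (t : R), `|t| < d -> is_derive t 1 (phi j) (phi j.+1 t)) ->
  (forall j, (j < k)%N -> phi j 0 = 0) -> phi k 0 < 0 ->
  exists2 e, 0 < e <= d & forall t, 0 < t < e -> phi 0 t < 0.
Proof.
move=> d0 dphi phi0 phik0.
have [e /andP[e0 led] phik] :
    exists2 e, 0 < e <= d & forall t, 0 < t < e -> phi k t < 0.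
  have : {for 0, continuous (phi k)}.
    apply: differentiable_continuous; apply/derivable1_diffP.
    have d0' : `|0 : R| < d by rewrite normr0.
    by have [] := dphi k 0 d0'.
  move=> /cvgr_lt/(_ _ phik0)/nbhs_ballP[e /= e0 phik].
  exists (Num.min e d); first by rewrite lt_min e0 d0 ge_min lexx orbT.
  move=> t /andP[t0]; rewrite lt_min => /andP[lte _]; apply: phik.
  by rewrite /ball /= sub0r normrN gtr0_norm.
exists e; first by rewrite e0.
suff H j : (j <= k)%N -> forall t, 0 < t < e -> phi (k - j)%N t < 0.
  by move=> t; have := H k (leqnn k) t; rewrite subnn.
elim: j => [_|j IHj ltjk] t; first by rewrite subn0; apply: phik.
move=> /andP[t0 te].
set i := (k - j.+1)%N; have iS : i.+1 = (k - j)%N by rewrite /i; lia.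
have nd x : 0 <= x <= t -> `|x| < d.
  by move=> /andP[x0 xt]; rewrite ger0_norm // (le_lt_trans xt) // (lt_le_trans te).
have [x||x] := MVT (f := phi i) (df := phi i.+1) t0.
- rewrite in_itv /= => /andP[x0 xt]; apply: dphi.
  by rewrite nd // !ltW.
- apply: derivable_within_continuous => x; rewrite in_itv /= => /nd xd.
  by have [] := dphi i x xd.
rewrite in_itv /= => /andP[x0 xt]; rewrite phi0; last by rewrite /i; lia.
rewrite !subr0 iS => ->; rewrite pmulr_llt0 // IHj ?(ltnW ltjk) // x0.
exact: lt_trans te.
Qed.

Section PathGraph.
Variables (R : realType) (n : nat).

Definition path_mx : 'M[R]_n :=
  \matrix_(i, j) ((i.+1 == j :> nat) || (j.+1 == i :> nat))%:R.

Lemma path_mx_sym : path_mx^T = path_mx.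
Proof. by apply/matrixP => i j; rewrite !mxE orbC. Qed.

(** The entries of the [j]-th power of the adjacency matrix count the walks with
    [j] steps. *)
Lemma path_mx_powers (U : 'M[R]_n) (y : nat -> R) : U *m U^T = 1%:M ->
  path_mx = spectral_mx U y -> forall j (a b : 'I_n),
  ((a + j < b)%N -> spectral_mx U (fun l => y l ^+ j) a b = 0) /\
  ((a + j)%N = b :> nat -> spectral_mx U (fun l => y l ^+ j) a b = 1).
Proof.
move=> U1 TE; elim=> [|j IHj] a b.
  have -> : spectral_mx U (fun l => y l ^+ 0) = 1%:M.
    rewrite /spectral_mx (_ : \row_i _ = const_mx 1); last first.
      by apply/rowP => l; rewrite !mxE expr0.
    by rewrite diag_const_mx mulmx1 U1.
  rewrite addn0 mxE -val_eqE /=; split=> [|->]; last by rewrite eqxx.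
  by move=> /ltn_eqF ->.
have -> : spectral_mx U (fun l => y l ^+ j.+1) =
    spectral_mx U (fun l => y l ^+ j) *m path_mx.
  rewrite TE spectral_mxM // /spectral_mx; congr (_ *m diag_mx _ *m _).
  by apply/rowP => l; rewrite !mxE exprSr.
rewrite mxE; split=> [ltab|eqab].
  rewrite big1 // => c _; have [ltac|leca] := ltnP (a + j) c.
    by rewrite (IHj a c).1 // mul0r.
  by rewrite [path_mx _ _]mxE (_ : _ || _ = false) ?mulr0 //; lia.
have ltc : (b.-1 < n)%N by have := ltn_ord b; lia.
rewrite (bigD1 (Ordinal ltc)) //= big1 => [|c neqc].
  rewrite (IHj a (Ordinal ltc)).2 /=; last by lia.
  by rewrite mxE (_ : _ || _ = true) ?mulr1 ?addr0 //=; lia.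
have [ltac|leca] := ltnP (a + j) c; first by rewrite (IHj a c).1 // mul0r.
rewrite [path_mx _ _]mxE (_ : _ || _ = false) ?mulr0 //.
by move: neqc; rewrite -val_eqE /=; lia.
Qed.

End PathGraph.

Definition falling (R : realType) (a : R) k : R := \prod_(i < k) (a - i%:R).

Lemma falling_negative (R : realType) (a : R) m :
  m%:R < a < m.+1%:R -> falling a m.+2 < 0.
Proof.
move=> /andP[ma am]; rewrite /falling big_ord_recr /= pmulr_rlt0 ?subr_lt0 //.
apply: prodr_gt0 => i _; rewrite subr_gt0; apply: le_lt_trans ma.
by rewrite ler_nat -ltnS.
Qed.

(** [phi j t] below is the [j]-th derivative of the entry [(0, m + 2)] of
    [(1 + t T) ^ a], where [T] is the adjacency matrix of a path. At [t = 0] it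
    is [falling a j] times the same entry of [T ^ j], which is [0] for
    [j < m + 2] and [1] for [j = m + 2]; so the entry is negative for small
    positive [t], where [1 + t T] is still doubly nonnegative. *)
Lemma not_preserves_DN (R : realType) n (a : R) m :
  m%:R < a < m.+1%:R -> (m.+2 < n)%N -> ~ preserves_DN n a.
Proof.
move=> ma ltmn pres.
have [U [y [U1 TE _]]] := symmetric_spectral_sorted (path_mx_sym R n).
rewrite -/(spectral_mx U y) in TE.
have lt0n : (0 < n)%N by lia.
pose i0 := Ordinal lt0n; pose k0 := Ordinal ltmn.
pose w (l : 'I_n) := U i0 l * U k0 l.
have powT := path_mx_powers U1 TE.
pose phi j t := falling a j * \sum_l w l * y l ^+ j * (1 + t * y l) `^ (a - j%:R).
(* For [|t| < d] all the eigenvalues of [1 + t T] are positive. *)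
pose d := (1 + \sum_(l < n) `|y l|)^-1.
have d0 : 0 < d by rewrite invr_gt0 ltr_pwDl // sumr_ge0.
have pos t (l : 'I_n) : `|t| < d -> 0 < 1 + t * y l.
  move=> td; have : `|t * y l| < 1.
    have [t0|tn0] := eqVneq t 0; first by rewrite t0 mul0r normr0.
    rewrite normrM -ltr_pdivlMl ?normr_gt0 // mulr1.
    apply: (@lt_trans _ _ (d^-1)); last by rewrite ltf_pV2 ?posrE ?normr_gt0.
    rewrite invrK (bigD1 l) //=.
    have : 0 <= \sum_(i < n | i != l) `|y i| by rewrite sumr_ge0.
    lra.
  by rewrite ltr_norml => /andP[]; lra.
have dphi j (t : R) : `|t| < d -> is_derive t 1 (phi j) (phi j.+1 t).
  move=> td.
  have -> : phi j.+1 t = falling a j *: \sum_l (w l * y l ^+ j) *: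
      ((a - j%:R) * (1 + t * y l) `^ (a - j%:R - 1) * y l).
    rewrite /phi /falling big_ord_recr /= -/(falling a j) -[LHS]mulrA; congr (_ * _).
    rewrite mulr_sumr; apply: eq_bigr => l _; rewrite /GRing.scale /= exprSr.
    by rewrite -natr1 opprD addrA; ring.
  have -> : phi j = falling a j \*: \sum_l (w l * y l ^+ j) \*:
      ((@powR R ^~ (a - j%:R)) \o (fun u => 1 + u * y l)).
    by apply/funext => u; rewrite /phi fct_sumE.
  apply: is_deriveZ; apply: is_derive_sum => l; apply: is_deriveZ.
  apply: is_derive1_comp; first by apply: is_derive1_powR; exact: pos.
  have -> : (fun u => 1 + u * y l) = cst 1 + y l *: (@id R).
    by apply/funext => u; rewrite fctE /= mulrC.
  rewrite -[X in is_derive _ _ _ X]add0r -[X in is_derive _ _ _ (_ + X)]mulr1.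
  by apply: is_deriveD; apply: is_deriveZ.
have phi_at0 j : phi j 0 = falling a j * spectral_mx U (fun l => y l ^+ j) i0 k0.
  rewrite /phi spectral_mxE; congr (_ * _); apply: eq_bigr => l _.
  by rewrite mul0r addr0 powR1 mulr1.
have phi0 j : (j < m.+2)%N -> phi j 0 = 0.
  by move=> ltj; rewrite phi_at0 (powT j i0 k0).1 ?mulr0 // add0n.
have phik : phi m.+2 0 < 0.
  by rewrite phi_at0 (powT m.+2 i0 k0).2 // mulr1 falling_negative.
have [e /andP[e0 led] phi_lt0] := taylor_negative d0 dphi phi0 phik.
pose t := e / 2.
have t0 : 0 < t by rewrite divr_gt0.
have te : t < e by rewrite /t; lra.
have td : `|t| < d by rewrite gtr0_norm // (lt_le_trans te).
pose z l := 1 + t * y l.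
have AE : spectral_mx U z = 1%:M + t *: path_mx R n.
  apply/matrixP => i j; rewrite TE -U1 [RHS]mxE [X in _ + X]mxE !spectral_mxE.
  rewrite [X in X + _]mxE mulr_sumr -big_split; apply: eq_bigr => l _.
  by rewrite [U^T _ _]mxE /z /=; ring.
have DNA : DN (spectral_mx U z).
  split.
    by apply: spectral_possemidef => l ltl; have := pos t (Ordinal ltl) td; apply: ltW.
  by move=> i j; rewrite AE !mxE addr_ge0 ?mulr_ge0 ?ler0n // ltW.
have [_ /(_ i0 k0)] := pres _ DNA.
rewrite powmx_spectral // spectral_mxE leNgt => /negP; apply.
have := phi_lt0 t; rewrite t0 te => /(_ isT).
rewrite /phi /falling big_ord0 mul1r.
by under eq_bigr do rewrite expr0 mulr1 subr0.
Qed.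

(** * The critical exponent *)

Lemma preserves_DN_iff (R : realType) (n : nat) (a : R) : (2 <= n)%N -> 0 <= a ->
  preserves_DN n a <-> (exists k : nat, a = k%:R) \/ n%:R - 2%:R <= a.
Proof.
move=> n2 a0.
have n2E : n%:R - 2%:R = (n - 2)%:R :> R by rewrite natrB.
rewrite n2E; split=> [pres|].
  have [[k ->]|[m ma]] := natural_part a0; first by left; exists k.
  right; have [lt2m|lem2] := ltnP m.+2 n.
    by case: (not_preserves_DN ma lt2m).
  apply: le_trans (ltW (andP ma).1); rewrite ler_nat; lia.
case=> [[k ->]|len]; first exact: preserves_DN_nat.
have [[k ->]|[m ma]] := natural_part a0; first exact: preserves_DN_nat.
case: n n2 n2E len => // n n2 _ len; apply: (preserves_DN_large ma).
have : (n.+1 - 2)%:R < m.+1%:R :> R by apply: le_lt_trans len (andP ma).2.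
by rewrite ltr_nat; lia.
Qed.

Unset Implicit Arguments.

Theorem corollary2p3 (R : realType) (n : nat) (n_ge2 : (2 <= n)%N) :
  is_critical_exponent n (n%:R - 2%:R : R) /\
  forall alpha : R, 0 <= alpha ->
    (preserves_DN n alpha <->
     (exists k : nat, alpha = k%:R) \/ n%:R - 2%:R <= alpha).
Proof.
split; last by move=> a; apply: preserves_DN_iff.
have n2E : n%:R - 2%:R = (n - 2)%:R :> R by rewrite natrB.
split.
  split=> [|a len]; first by rewrite n2E ler0n.
  apply/preserves_DN_iff => //; last by right.
  by apply: le_trans len; rewrite n2E ler0n.
move=> mu /= [mu0 pres]; rewrite leNgt; apply/negP => lt_mu.
have [nat_mu|nnat_mu] := pselect (exists k : nat, mu = k%:R); last first.
  have /(preserves_DN_iff n_ge2 mu0)[//|] := pres mu (lexx mu).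
  by rewrite leNgt lt_mu.
(* An integral [mu] below [n - 2] is followed by the non-integral [mu + 1 / 2],
   which is still below [n - 2]. *)
have [k muE] := nat_mu; pose a := mu + 2^-1.
have ltk : (k < n - 2)%N by rewrite -(ltr_nat R) -n2E -muE.
have a_lt : a < n%:R - 2%:R.
  have : k.+1%:R <= (n - 2)%:R :> R by rewrite ler_nat.
  by rewrite -natr1 n2E /a muE; lra.
have a0 : 0 <= a by rewrite /a; lra.
have le_mua : mu <= a by rewrite /a; lra.
have /(preserves_DN_iff n_ge2 a0)[[l aE]|] := pres a le_mua; last first.
  by rewrite leNgt a_lt.
have /andP[] : k%:R < a < k.+1%:R by rewrite -natr1 /a muE; lra.
by rewrite aE !ltr_nat; lia.
Qed.
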